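(* Let $G=(V,E)$ be a directed acyclic graph. Suppose that there exists (i) a sink node $s\in V$ such that $pa(s)\neq V\setminus\{s\}$ and the model $\mathcal{N}_*(G')$ of the induced subgraph $G'$ of $G$ on $V\setminus\{s\}$ is generically finitely identifiable, or (ii) a source node $s\in V$ such that $ch(s)\neq V\setminus\{s\}$ and the model $\mathcal{N}_*(G')$ of the induced subgraph $G'$ of $G$ on $V\setminus\{s\}$ is generically finitely identifiable. Then the model $\mathcal{N}_*(G)$ is generically finitely identifiable.
   Context: For a directed acyclic graph (DAG) $G=(V,E)$ with $m=|V|$ nodes (rows and columns of $m\times m$ matrices and entries of $m$-vectors are indexed by $V$), let $\mathbb{R}_E=\{\Lambda=(\lambda_{wv})\in\mathbb{R}^{m\times m}: w\to v\notin E\Rightarrow \lambda_{wv}=0\}$, let $\mathrm{diag}_m^+$ be the set of $m\times m$ diagonal matrices with positive diagonal, and let $\Theta=\mathbb{R}_E\times \mathrm{diag}_m^+\times\mathbb{R}^m$, regarded as an open subset of $\mathbb{R}^{2m+|E|}$. The model $\mathcal{N}_*(G)$ is the family of normal distributions $N_m(0,\Sigma)$ with $\Sigma$ in the image of $$\phi_G:\Theta\to\mathbb{R}^{m\times m},\qquad \phi_G(\Lambda,\Omega,\delta)=(I_m-\Lambda^T)^{-1}(\Omega+\delta\delta^T)(I_m-\Lambda)^{-1}.$$ An algebraic set in $\mathbb{R}^n$ is the common zero set of finitely many real polynomials; it is proper if it is not all of $\mathbb{R}^n$. A map $f$ defined on an open set $S\subset\mathbb{R}^n$ is generically finite-to-one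 if there is a proper algebraic set $\tilde S\subset\mathbb{R}^n$ such that for every $s\in S\setminus\tilde S$ the fiber $\{s'\in S: f(s')=f(s)\}$ is finite. The model $\mathcal{N}_*(G)$ is generically finitely identifiable if $\phi_G$ is generically finite-to-one on $\Theta$. For $v\in V$, $pa(v)=\{w: w\to v\in E\}$ and $ch(v)=\{w: v\to w\in E\}$. A node $s$ is a sink node if there is no $s'\in V$ with $s\to s'\in E$, and a source node if there is no $s'\in V$ with $s'\to s\in E$. *)

(* Defs.v *)
From HB Require Import structures.
From mathcomp Require Import all_boot all_order all_algebra.
From mathcomp Require Import mpoly.
From mathcomp Require Import boolp classical_sets functions cardinality reals.

Set Implicit Arguments.
Unset Strict Implicit.
Unset Printing Implicit Defensive.

Import Order.TTheory GRing.Theory Num.Theory.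

Local Open Scope classical_set_scope.
Local Open Scope ring_scope.

Section Digraph.
Variables (V : finType) (E : rel V).

(* Closed walks need not be simple here; every nonempty closed walk contains
   a simple directed cycle, so this is the usual acyclicity (loops included). *)
Definition acyclic : Prop := forall c : seq V, cycle E c -> c = [::].

Definition pa (v : V) : {set V} := [set w | E w v]%SET.
Definition ch (v : V) : {set V} := [set w | E v w]%SET.

Definition sink (s : V) : Prop := ~ exists s', E s s'.
Definition source (s : V) : Prop := ~ exists s', E s' s.

Definition induced_subgraph (W : {set V}) : rel {v : V | v \in W} :=
  fun v w => E (val v) (val w).

Definition edge := {e : V * V | E e.1 e.2}.

End Digraph.

Arguments induced_subgraph {V} E W.

Section AlgebraicGeometry.
Variables (R : realType) (n : nat).

Definition algebraic_set (A : set 'rV[R]_n) : Prop :=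
  exists ps : seq {mpoly R[n]},
    A = [set x | forall p, p \in ps -> p.@[fun i => x ord0 i] = 0].

Definition generically_finite_to_one (T : Type) (S : set 'rV[R]_n)
    (f : 'rV[R]_n -> T) : Prop :=
  exists A : set 'rV[R]_n,
    [/\ algebraic_set A, A <> setT &
        forall x, S x -> ~ A x -> finite_set [set y | S y /\ f y = f x]].

End AlgebraicGeometry.

Section Model.
Variables (R : realType) (V : finType) (E : rel V).

(* A matrix indexed by V is a square matrix of size #|V|; its (w, v) entry is
   the one at row enum_rank w and column enum_rank v. *)
Definition R_E : set 'M[R]_#|V| :=
  [set L | forall w v, ~~ E w v -> L (enum_rank w) (enum_rank v) = 0].

Definition diag_pos : set 'M[R]_#|V| :=
  [set Om | is_diag_mx Om /\ forall i, 0 < Om i i].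

Definition Theta : set ('M[R]_#|V| * 'M[R]_#|V| * 'cV[R]_#|V|) :=
  R_E `*` diag_pos `*` setT.

Definition phi (t : 'M[R]_#|V| * 'M[R]_#|V| * 'cV[R]_#|V|) : 'M[R]_#|V| :=
  let: (L, Om, d) := t in
  invmx (1%:M - L^T) *m (Om + d *m d^T) *m invmx (1%:M - L).

(* One real coordinate for each edge weight, each diagonal entry of Omega and
   each entry of delta. *)
Definition param_index : finType := (edge E + V + V)%type.

Definition of_coord (x : 'rV[R]_#|{: param_index}|) :
    'M[R]_#|V| * 'M[R]_#|V| * 'cV[R]_#|V| :=
  let c (k : param_index) := x ord0 (enum_rank k) in
  (\matrix_(i, j)
     (if insub (enum_val i, enum_val j) is Some e then c (inl (inl e)) else 0),
   diag_mx (\row_i c (inl (inr (enum_val i)))),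
   \col_i c (inr (enum_val i))).

Definition generically_finitely_identifiable : Prop :=
  generically_finite_to_one (of_coord @^-1` Theta) (phi \o of_coord).

Lemma card_param_index : #|{: param_index}| = (2 * #|V| + #|{: edge E}|)%N.
Proof. by rewrite !card_sum mul2n -addnn -addnA addnC. Qed.

(* The coordinates identify Theta with an (open) subset of R^(2m+|E|). *)
Lemma of_coord_bij : set_bij (of_coord @^-1` Theta) Theta of_coord.
Proof.
split.
- by move=> x /=.
- move=> x y _ _ [] /matrixP eL /matrixP eO /matrixP ed.
  apply/rowP => k; rewrite -(enum_valK k).
  case: (enum_val k) => [[e|v]|v].
  + have := eL (enum_rank (val e).1) (enum_rank (val e).2).
    by rewrite !mxE !enum_rankK -surjective_pairing valK.
  + have := eO (enum_rank v) (enum_rank v).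
    by rewrite !mxE eqxx !mulr1n enum_rankK.
  + by have := ed (enum_rank v) 0; rewrite !mxE enum_rankK.
- move=> [[L Om] d] Th; have [[/= LE [/is_diag_mxP dO pO]] _] := Th.
  pose x : 'rV[R]_#|{: param_index}| := \row_k
    match enum_val k with
    | inl (inl e) => L (enum_rank (val e).1) (enum_rank (val e).2)
    | inl (inr v) => Om (enum_rank v) (enum_rank v)
    | inr v => d (enum_rank v) 0
    end.
  have xE : of_coord x = (L, Om, d).
    congr (_, _, _).
    + apply/matrixP => i j; rewrite mxE; case: insubP => [e Ee ve|nE].
        by rewrite !mxE enum_rankK ve /= !enum_valK.
      by rewrite -(enum_valK i) -(enum_valK j) LE.
    + apply/matrixP => i j; rewrite !mxE enum_rankK enum_valK.
      by have [->|ne] := eqVneq i j; rewrite ?mulr1n // mulr0n dO.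
    + by apply/matrixP => i j; rewrite !mxE enum_rankK enum_valK (ord1 j).
  by exists x => //=; rewrite xE.
Qed.

End Model.

(* Main.v *)
Require Import Defs.
From mathcomp Require Import all_boot all_order all_algebra reals.
From mathcomp Require Import mpoly boolp classical_sets cardinality.
From mathcomp Require Import ring lra.

(** Throughout, the parameters [(L, Om, d)] are recovered from the covariance
    matrix [S] through the equation [(1 - L)^T S (1 - L) = Om + d d^T]; for an
    acyclic graph [1 - L] is invertible, so this equation says [S = phi (L, Om, d)]
    ([phiP]).  Genericity means that one polynomial function of the parameters
    does not vanish ([identifiableP]).  In both cases the fiber of a generic
    parameter is mapped injectively into a fiber of the model on the other
    nodes, which is finite because a polynomial condition on the smaller model
    pulls back to one on the larger model.  What needs care is that a generic
    condition holds at the given parameter but not automatically at the other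
    points of its fiber; each case gets around this with a condition that can
    be read off from [S].

    Sink.  Restricting all matrices to the nodes other than [s] gives a point
    of the smaller model ([sink_marginal]), and the remaining unknowns, the
    weights [l] into [s] and the loading [a] of [s], solve the linear system
    [S' l + a C = sg], where [C] and [sg] are the covariances of the other nodes
    with the latent variable and with [s]; the noise variance of [s] then
    follows ([sink_variance]).  If a fiber point admits two
    solutions then [C] there is a combination of the columns of [S'] indexed by
    the parents of [s], hence so is [sg].  The latter does not depend on the
    fiber point, and is false at a generic parameter because some node is not a
    parent of [s] ([sink_not_regression], [sink_solution_unique]).

    Source.  Conditioning on [s] leaves the other nodes in the smaller model,
    with the latent variance shrunk by the factor [Om s s / S s s]
    ([source_conditional]).  Its square root would spoil polynomiality, so
    covariances are multiplied by the number [Om s s * S s s] taken at the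
    generic parameter.  A point of the smaller fiber determines [L] and [Om]
    off [s] and a multiple of [d] off [s]; for a node [v] that is not a child of
    [s] the covariance with [s] also gives the product of the loadings of [s]
    and [v], and the two together determine the remaining unknowns up to one
    sign, provided [v] has nonzero loading ([sqrt_scale_inj]).  A zero loading
    of [v] anywhere in the fiber would make [s] and [v] independent given the
    parents of [v], which is an equation between entries of [S] failing at a
    generic parameter ([pa_minor_vanishes], [pa_minor_neq0]). *)

Set Implicit Arguments.
Unset Strict Implicit.
Unset Printing Implicit Defensive.

Import Order.TTheory GRing.Theory Num.Theory.

Local Open Scope classical_set_scope.
Local Open Scope ring_scope.

(** * Polynomial functions *)

Definition polyfun (R : realType) n (f : 'rV[R]_n -> R) : Prop :=
  exists p : {mpoly R[n]}, forall x, f x = p.@[fun i => x ord0 i].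

Section PolynomialFunctions.
Variables (R : realType) (n : nat).
Implicit Types f g : 'rV[R]_n -> R.

Lemma eq_polyfun f g : f =1 g -> polyfun f -> polyfun g.
Proof. by move=> fg [p fE]; exists p => x; rewrite -fg. Qed.

Lemma polyfun_cst c : polyfun (fun _ : 'rV[R]_n => c).
Proof. by exists c%:MP => x; rewrite mevalC. Qed.

Lemma polyfun_coord i : polyfun (fun x : 'rV[R]_n => x ord0 i).
Proof. by exists 'X_i => x; rewrite mevalXU. Qed.

Lemma polyfunD f g : polyfun f -> polyfun g -> polyfun (fun x => f x + g x).
Proof. by move=> [p fE] [q gE]; exists (p + q) => x; rewrite mevalD fE gE. Qed.

Lemma polyfunM f g : polyfun f -> polyfun g -> polyfun (fun x => f x * g x).
Proof. by move=> [p fE] [q gE]; exists (p * q) => x; rewrite mevalM fE gE. Qed.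

Lemma polyfunN f : polyfun f -> polyfun (fun x => - f x).
Proof. by move=> [p fE]; exists (- p) => x; rewrite mevalN fE. Qed.

Lemma polyfun_sum (I : finType) (F : I -> 'rV[R]_n -> R) :
  (forall i, polyfun (F i)) -> polyfun (fun x => \sum_i F i x).
Proof.
move=> /fin_all_exists[p pE]; exists (\sum_i p i) => x.
by rewrite raddf_sum; apply: eq_bigr => i _; rewrite pE.
Qed.

Lemma polyfun_prod (I : finType) (F : I -> 'rV[R]_n -> R) :
  (forall i, polyfun (F i)) -> polyfun (fun x => \prod_i F i x).
Proof.
move=> /fin_all_exists[p pE]; exists (\prod_i p i) => x.
by rewrite rmorph_prod; apply: eq_bigr => i _; rewrite pE.
Qed.

Lemma polyfun_comp m (F : 'rV[R]_n -> 'rV[R]_m) (f : 'rV[R]_m -> R) :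
  polyfun f -> (forall j, polyfun (fun x => F x ord0 j)) ->
  polyfun (f \o F).
Proof.
move=> [p fE] /fin_all_exists[q qE]; exists (p \mPo [tuple q j | j < m]) => x.
rewrite comp_mpoly_meval /= fE; apply: meval_eq => j.
by rewrite tnth_mktuple qE.
Qed.

(** Along a line a polynomial function is a univariate polynomial. *)
Lemma polyfun_line f (x y : 'rV[R]_n) :
  polyfun f -> exists p : {poly R}, forall t, f (x + t *: y) = p.[t].
Proof.
move=> [p fE]; exists (\sum_(m <- msupp p)
  (p@_m)%:P * \prod_i ((x ord0 i)%:P + (y ord0 i)%:P * 'X) ^+ m i) => t.
rewrite fE mevalE horner_sum; apply: eq_bigr => m _.
rewrite hornerM hornerC horner_prod; congr (_ * _); apply: eq_bigr => i _.
by rewrite !hornerE !mxE mulrC.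
Qed.

(** Join a point where [f] does not vanish to a point where [g] does not: on
    that line both are nonzero univariate polynomials, so their product is a
    nonzero polynomial over an infinite field. *)
Lemma polyfunM_neq0 f g :
  polyfun f -> polyfun g ->
  (exists x, f x != 0) -> (exists x, g x != 0) -> exists x, f x * g x != 0.
Proof.
move=> Pf Pg [x fx] [y gy].
have [p pE] := polyfun_line x (y - x) Pf.
have [q qE] := polyfun_line x (y - x) Pg.
have p0 : p != 0.
  by apply: contraNneq fx => p0; rewrite -[x]addr0 -(scale0r (y - x)) pE p0 horner0.
have q0 : q != 0.
  apply: contraNneq gy => q0.
  by rewrite -[y](subrKC x) -[y - x]scale1r qE q0 horner0.
have pq0 : p * q != 0 by rewrite mulf_neq0.
pose s : seq R := [seq k%:R | k <- iota 0 (size (p * q)%R)].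
have [z _ nz] : exists2 z, z \in s & ~~ root (p * q) z.
  apply/allPn; apply/negP => rs.
  have := max_poly_roots pq0 rs; rewrite size_map size_iota ltnn => /(_ _) nu.
  apply/negP/nu: isT; rewrite map_inj_uniq ?iota_uniq //.
  exact: mulrIn (oner_neq0 R).
by exists (x + z *: (y - x)); rewrite pE qE -hornerM.
Qed.

(** * Polynomial matrix-valued functions *)

Definition polymx a b (F : 'rV[R]_n -> 'M[R]_(a, b)) : Prop :=
  forall i j, polyfun (fun x => F x i j).

Lemma polymx_cst a b (A : 'M[R]_(a, b)) : polymx (fun=> A).
Proof. by move=> i j; exact: polyfun_cst. Qed.

Lemma polymxD a b (F G : 'rV[R]_n -> 'M[R]_(a, b)) :
  polymx F -> polymx G -> polymx (fun x => F x + G x).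
Proof.
move=> PF PG i j; apply: (eq_polyfun _ (polyfunD (PF i j) (PG i j))) => x.
by rewrite mxE.
Qed.

Lemma polymxN a b (F : 'rV[R]_n -> 'M[R]_(a, b)) :
  polymx F -> polymx (fun x => - F x).
Proof.
by move=> PF i j; apply: (eq_polyfun _ (polyfunN (PF i j))) => x; rewrite mxE.
Qed.

Lemma polymxZ a b (f : 'rV[R]_n -> R) (F : 'rV[R]_n -> 'M[R]_(a, b)) :
  polyfun f -> polymx F -> polymx (fun x => f x *: F x).
Proof.
by move=> Pf PF i j; apply: (eq_polyfun _ (polyfunM Pf (PF i j))) => x; rewrite mxE.
Qed.

Lemma polymx_tr a b (F : 'rV[R]_n -> 'M[R]_(a, b)) :
  polymx F -> polymx (fun x => (F x)^T).
Proof. by move=> PF i j; apply: (eq_polyfun _ (PF j i)) => x; rewrite mxE. Qed.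

Lemma polymxM a b c (F : 'rV[R]_n -> 'M[R]_(a, b))
    (G : 'rV[R]_n -> 'M[R]_(b, c)) :
  polymx F -> polymx G -> polymx (fun x => F x *m G x).
Proof.
move=> PF PG i j.
apply: (eq_polyfun _ (polyfun_sum (fun k => polyfunM (PF i k) (PG k j)))) => x.
by rewrite mxE.
Qed.

Lemma polyfun_det a (F : 'rV[R]_n -> 'M[R]_a) :
  polymx F -> polyfun (fun x => \det (F x)).
Proof.
move=> PF; apply: polyfun_sum => s; apply: polyfunM; first exact: polyfun_cst.
by apply: polyfun_prod => i; exact: PF.
Qed.

Lemma polymx_adj a (F : 'rV[R]_n -> 'M[R]_a) :
  polymx F -> polymx (fun x => \adj (F x)).
Proof.
move=> PF i j.
have Pc : polyfun (fun x => cofactor (F x) j i).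
  apply: polyfunM; first exact: polyfun_cst.
  apply: polyfun_det => k l; apply: (eq_polyfun _ (PF (lift j k) (lift i l))) => x.
  by rewrite !mxE.
by apply: (eq_polyfun _ Pc) => x; rewrite mxE.
Qed.

End PolynomialFunctions.

(** * Generic finiteness through one polynomial function *)

Lemma finite_set_inj (T U : Type) (A : set T) (B : set U) (f : T -> U) :
  finite_set B -> (forall x, A x -> B (f x)) ->
  (forall x y, A x -> A y -> f x = f y -> x = y) -> finite_set A.
Proof.
move=> finB AB injf.
have cA : (f @` A #= A)%card.
  by apply: inj_card_eq => x y; rewrite !inE; exact: injf.
rewrite -(eq_finite_set cA); apply: sub_finite_set finB.
by move=> _ [x Ax <-]; exact: AB.
Qed.

(** The finite-to-one condition only asks for a proper algebraic set, and a
    single equation already cuts out a larger proper one; so genericity is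
    nonvanishing of one polynomial function.  The fibers are moved from the
    coordinate space to the triples of matrices they stand for. *)
Lemma identifiableP (R : realType) (V : finType) (E : rel V) :
  generically_finitely_identifiable R E <->
  exists g : 'rV[R]_#|{: param_index E}| -> R,
    [/\ polyfun g, exists x, g x != 0 &
        forall x, Theta E (of_coord x) -> g x != 0 ->
          finite_set [set t | Theta E t /\ phi t = phi (of_coord x)]].
Proof.
have [_ inj_c sur_c] := of_coord_bij R E.
split=> [[A [[ps AE] AT fin]]|[g [[p gE] [x0 gx0] fin]]].
  have [x0 nAx0] : exists x0, ~ A x0 by apply/existsNP => AA; apply/AT/seteqP; split.
  have [p pps px0] : exists2 p, p \in ps & p.@[fun i => x0 ord0 i] != 0.
    apply: contra_notP nAx0 => nx; rewrite AE => p pps; apply/eqP.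
    by apply: contra_notT nx => px; exists p.
  exists (fun x => p.@[fun i => x ord0 i]); split; [by exists p|by exists x0|].
  move=> x Tx px; have /fin : ~ A x by rewrite AE => /(_ p pps)/eqP; apply/negP.
  move=> /(_ Tx)/(finite_image (@of_coord R V E)); apply: sub_finite_set.
  move=> t [Tt te]; have [y Ty yt] := sur_c t Tt.
  by exists y; last exact: yt; split=> //; exact: (etrans (congr1 (@phi R V) yt)).
exists [set x | g x = 0]; split.
- exists [:: p]; apply/seteqP; split=> x /=.
    by move=> gx q; rewrite inE => /eqP ->; rewrite -gE.
  by move=> /(_ p); rewrite mem_seq1 eqxx gE; exact.
- move=> gT; have gx00 : [set x | g x = 0] x0 by rewrite gT.
  by move/eqP: gx0; exact.
- move=> x Tx /eqP gx; apply: (finite_set_inj (f := @of_coord R V E) (fin x Tx gx)).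
    by move=> y [Ty ye]; split.
  by move=> y z [Ty _] [Tz _]; apply: inj_c; rewrite inE.
Qed.

Section Coordinates.
Variables (R : realType) (V : finType) (E : rel V).

Lemma polymx_of_coord1 :
  polymx (fun x : 'rV[R]_#|{: param_index E}| => (of_coord x).1.1).
Proof.
move=> i j; case Ee: (insub (enum_val i, enum_val j) : option (edge E)) => [e|].
  apply: (eq_polyfun _ (polyfun_coord R (enum_rank (inl (inl e) : param_index E)))) => x.
  by rewrite mxE Ee.
by apply: (eq_polyfun _ (polyfun_cst _ 0)) => x; rewrite mxE Ee.
Qed.

Lemma polymx_of_coord2 :
  polymx (fun x : 'rV[R]_#|{: param_index E}| => (of_coord x).1.2).
Proof.
move=> i j; have [->|ij] := eqVneq i j.
  apply: (eq_polyfun _ (polyfun_coord R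
    (enum_rank (inl (inr (enum_val j)) : param_index E)))) => x.
  by rewrite !mxE eqxx mulr1n.
apply: (eq_polyfun _ (polyfun_cst _ 0)) => x.
by rewrite !mxE (negPf ij) mulr0n.
Qed.

Lemma polymx_of_coord3 :
  polymx (fun x : 'rV[R]_#|{: param_index E}| => (of_coord x).2).
Proof.
move=> i j; apply: (eq_polyfun _ (polyfun_coord R
  (enum_rank (inr (enum_val i) : param_index E)))) => x.
by rewrite !mxE.
Qed.

Definition coord (t : 'M[R]_#|V| * 'M[R]_#|V| * 'cV[R]_#|V|) :
    'rV[R]_#|{: param_index E}| :=
  \row_k match enum_val k with
    | inl (inl e) => t.1.1 (enum_rank (val e).1) (enum_rank (val e).2)
    | inl (inr v) => t.1.2 (enum_rank v) (enum_rank v)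
    | inr v => t.2 (enum_rank v) 0
    end.

Lemma of_coordK : cancel (@of_coord R V E) coord.
Proof.
move=> x; apply/rowP => k; rewrite mxE -{2}(enum_valK k).
case: (enum_val k) => [[e|v]|v]; rewrite !mxE /= ?enum_rankK //.
  by rewrite -surjective_pairing valK.
by rewrite eqxx mulr1n.
Qed.

Lemma coordK L Om d : R_E E L -> is_diag_mx Om ->
  of_coord (coord (L, Om, d)) = (L, Om, d).
Proof.
move=> LE /is_diag_mxP dO; congr (_, _, _).
- apply/matrixP => i j; rewrite mxE; case: insubP => [e Ee ve|nE].
    by rewrite !mxE enum_rankK ve /= !enum_valK.
  by rewrite -(enum_valK i) -(enum_valK j) LE.
- apply/matrixP => i j; rewrite !mxE enum_rankK enum_valK.
  by have [->|ne] := eqVneq i j; rewrite ?mulr1n // mulr0n dO.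
- by apply/matrixP => i j; rewrite !mxE enum_rankK enum_valK (ord1 j).
Qed.

Lemma polyfun_coords n (F : 'rV[R]_n -> 'M[R]_#|V| * 'M[R]_#|V| * 'cV[R]_#|V|)
    (g : 'rV[R]_#|{: param_index E}| -> R) :
  polyfun g -> polymx (fun x => (F x).1.1) -> polymx (fun x => (F x).1.2) ->
  polymx (fun x => (F x).2) -> polyfun (fun x => g (coord (F x))).
Proof.
move=> Pg P1 P2 P3; apply: polyfun_comp Pg _ => k.
by under eq_fun do rewrite mxE; case: (enum_val k) => [[e|v]|v].
Qed.

End Coordinates.
Arguments coord {R V} E t.

(** * Acyclicity and the covariance equation *)

Section Acyclic.
Variables (R : realType) (V : finType) (E : rel V).
Hypothesis acyclicE : acyclic E.

Lemma acyclic_connectF u w : E u w -> connect E w u -> False.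
Proof.
move=> Euw /connectP[p wp pu].
suff /acyclicE: cycle E (w :: p) by [].
by rewrite /= rcons_path wp -pu.
Qed.

Lemma acyclic_card_connect u w : E u w ->
  (#|[pred x | connect E x u]| < #|[pred x | connect E x w]|)%N.
Proof.
move=> Euw; apply/proper_card/properP; split.
  apply/fintype.subsetP => x; rewrite !inE => /connect_trans; apply; exact: connect1.
exists w; rewrite inE ?connect0 //; apply/negP; exact: acyclic_connectF.
Qed.

(** Off a set closed under outgoing edges, the equation [x (1 - L) = y] only
    involves entries of [x] off that set; when [y] is zero there, it says that
    every entry of [x] there is a combination of the entries at its parents,
    so induction along the acyclic order kills them all. *)
Lemma closed_support (L : 'M[R]_#|V|) (D : pred V) (x : 'rV[R]_#|V|) :
  R_E E L -> (forall u w, D u -> E u w -> D w) ->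
  (forall w, ~~ D w -> (x *m (1%:M - L)) ord0 (enum_rank w) = 0) ->
  forall w, ~~ D w -> x ord0 (enum_rank w) = 0.
Proof.
move=> LE Dcl xD w; have [k] := ubnP #|[pred u | connect E u w]|.
elim: k w => // k IHk w wk nDw; have := xD w nDw.
rewrite mulmxBr mulmx1 !mxE big1 ?subr0 // => i _.
rewrite -(enum_valK i); case Eiw: (E (enum_val i) w); last first.
  by rewrite LE ?Eiw ?mulr0.
rewrite IHk ?mul0r //; last by apply: contra nDw => /Dcl; exact.
by rewrite (leq_trans (acyclic_card_connect Eiw)).
Qed.

Lemma unitmx_1B (L : 'M[R]_#|V|) : R_E E L -> 1%:M - L \in unitmx.
Proof.
move=> LE; rewrite -row_free_unit; apply/inj_row_free => x x0.
apply/rowP => i; rewrite -(enum_valK i) mxE.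
by apply: (closed_support (D := pred0) LE) => // w _; rewrite x0 mxE.
Qed.

Lemma phiP (L Om : 'M[R]_#|V|) d S : R_E E L ->
  phi (L, Om, d) = S <-> (1%:M - L)^T *m S *m (1%:M - L) = Om + d *m d^T.
Proof.
move=> /unitmx_1B uB; have BT : 1%:M - L^T = (1%:M - L)^T.
  by rewrite linearB /= trmx1.
have uBT : (1%:M - L)^T \in unitmx by rewrite unitmx_tr.
rewrite /phi BT; split=> [<-|<-].
  by rewrite !mulmxA mulmxV // mul1mx mulmxKV.
by rewrite -!mulmxA mulmxV // mulmx1 mulmxA mulVmx // mul1mx.
Qed.

End Acyclic.

Lemma posdef_diag_add_rank1 (R : realType) n (Om : 'M[R]_n) (d x : 'cV[R]_n) :
  is_diag_mx Om -> (forall i, 0 < Om i i) -> (Om + d *m d^T) *m x = 0 -> x = 0.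
Proof.
move=> /is_diag_mxP dO pO /(congr1 (mulmx x^T)).
rewrite mulmx0 mulmxDl mulmxDr => /matrixP/(_ ord0 ord0).
have -> : x^T *m (d *m d^T *m x) = (d^T *m x)^T *m (d^T *m x).
  by rewrite trmx_mul trmxK !mulmxA.
have qE : (x^T *m (Om *m x)) ord0 ord0 = \sum_i Om i i * x i ord0 ^+ 2.
  rewrite mxE; apply: eq_bigr => i _; rewrite !mxE (bigD1 i) //= big1.
    by rewrite addr0; ring.
  by move=> j ji; rewrite dO ?mul0r // eq_sym.
have sq_ge0 (y : 'cV[R]_1) : 0 <= (y^T *m y) ord0 ord0.
  by rewrite mxE big_ord1 mxE; exact: sqr_ge0.
rewrite mxE qE [RHS]mxE => e0.
have xi0 i : Om i i * x i ord0 ^+ 2 = 0.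
  have /eqP : \sum_i Om i i * x i ord0 ^+ 2 = 0.
    apply/eqP; rewrite eq_le sumr_ge0 ?andbT; last first.
      by move=> j _; rewrite mulr_ge0 ?sqr_ge0 ?ltW.
    by have := sq_ge0 (d^T *m x); lra.
  rewrite psumr_eq0; last by move=> j _; rewrite mulr_ge0 ?sqr_ge0 ?ltW.
  by move=> /allP/(_ i)/(_ (mem_index_enum _))/eqP.
apply/colP => i; rewrite mxE; apply/eqP.
by have /eqP := xi0 i; rewrite mulf_eq0 expf_eq0 gt_eqF //= .
Qed.

(** * Splitting off one coordinate *)

Section ModelEquation.
Variable R : realType.

Definition model_eq n (S L Om : 'M[R]_n) (d : 'cV[R]_n) : Prop :=
  (1%:M - L)^T *m S *m (1%:M - L) = Om + d *m d^T.

Lemma mx11_factor n (a : 'cV[R]_n) (b : 'M[R]_1) : a *m b = b ord0 ord0 *: a.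
Proof. by rewrite {1}(mx11_scalar b) mul_mx_scalar. Qed.

Lemma model_eq_inj n (S L Om : 'M[R]_n) (d x : 'cV[R]_n) :
  model_eq S L Om d -> 1%:M - L \in unitmx -> is_diag_mx Om ->
  (forall i, 0 < Om i i) -> (1%:M - L)^T *m (S *m x) = 0 -> x = 0.
Proof.
move=> eqS uB dO pO; rewrite -{1}(mulKVmx uB x) !mulmxA eqS -mulmxA => e0.
by rewrite -(mulKVmx uB x) (posdef_diag_add_rank1 dO pO e0) mulmx0.
Qed.

(** At a generic parameter the regression of the sink on the other nodes does
    not stay within its parents: an identity [sg = S *m mu] with [mu] vanishing
    at a non-parent [v] makes [invmx S *m C], for the covariance [C] of the
    other nodes with the latent variable, vanish at [v] too.  That vector is
    proportional to [(1 - L) *m invmx Om *m d], and the adjugate clears its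
    denominator. *)
Lemma sink_not_regression n (S L Om : 'M[R]_n) (d l sg mu : 'cV[R]_n) a v :
  model_eq S L Om d -> 1%:M - L \in unitmx -> is_diag_mx Om ->
  (forall i, 0 < Om i i) -> a != 0 -> l v ord0 = 0 ->
  (1%:M - L)^T *m (sg - S *m l) = a *: d ->
  ((1%:M - L) *m \adj Om *m d) v ord0 != 0 ->
  mu v ord0 = 0 -> sg <> S *m mu.
Proof.
move=> eqS uB dO pO a0 lv eql hv muv sgE.
pose ka := a^-1 *: (mu - l); pose y := invmx (1%:M - L) *m ka.
have kaE : ka = (1%:M - L) *m y by rewrite mulKVmx.
have kav : ka v ord0 = 0 by rewrite !mxE lv muv; ring.
have dE : (Om + d *m d^T) *m y = d.
  rewrite -eqS -mulmxA -kaE -mulmxA /ka -!scalemxAr mulmxBr -sgE eql.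
  by rewrite scalerA mulVf // scale1r.
have yE : Om *m y = (1 - (d^T *m y) ord0 ord0) *: d.
  by rewrite scalerBl scale1r -{1}dE mulmxDl -(mulmxA d) mx11_factor addrK.
have adjE : \det Om *: ka =
    (1 - (d^T *m y) ord0 ord0) *: ((1%:M - L) *m \adj Om *m d).
  rewrite scalemxAr -yE -mulmxA (mulmxA (\adj Om)) mul_adj_mx mul_scalar_mx.
  by rewrite -scalemxAr -kaE.
have c0 : 1 - (d^T *m y) ord0 ord0 = 0.
  have /matrixP/(_ v ord0) := adjE; rewrite mxE kav mulr0 mxE => /esym/eqP.
  by rewrite mulf_eq0 (negPf hv) orbF => /eqP.
have y0 : y = 0.
  apply: (@posdef_diag_add_rank1 _ _ Om 0 y) => //.
  by rewrite mul0mx addr0 yE c0 scale0r.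
by move: hv; rewrite -dE y0 !mulmx0 mxE eqxx.
Qed.

(** Two solutions for the sink with different latent loadings exhibit the
    latent direction, hence [sg] itself, as a regression on the parents. *)
Lemma sink_solution_unique n (S L Om : 'M[R]_n) (d l1 l2 sg : 'cV[R]_n) a1 a2 v :
  model_eq S L Om d -> 1%:M - L \in unitmx -> is_diag_mx Om ->
  (forall i, 0 < Om i i) -> l1 v ord0 = 0 -> l2 v ord0 = 0 ->
  (1%:M - L)^T *m (sg - S *m l1) = a1 *: d ->
  (1%:M - L)^T *m (sg - S *m l2) = a2 *: d ->
  (forall mu : 'cV[R]_n, mu v ord0 = 0 -> sg <> S *m mu) ->
  l1 = l2 /\ a1 = a2.
Proof.
move=> eqS uB dO pO l1v l2v eq1 eq2 nreg.
have diffE : (1%:M - L)^T *m (S *m (l1 - l2)) = (a2 - a1) *: d.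
  by rewrite scalerBl -eq1 -eq2 !mulmxBr opprB [RHS]addrC addrA subrK.
have [a12|a12] := eqVneq a1 a2.
  split=> //; apply/subr0_eq/(model_eq_inj eqS uB dO pO).
  by rewrite diffE a12 subrr scale0r.
have a21 : a2 - a1 != 0 by rewrite subr_eq0 eq_sym.
case: (nreg (l1 + (a1 / (a2 - a1)) *: (l1 - l2))).
  by rewrite !mxE l1v l2v; ring.
apply/subr0_eq; have uBT : (1%:M - L)^T \in unitmx by rewrite unitmx_tr.
rewrite -[LHS](mulKmx uBT) (mulmxDr S) opprD addrA mulmxBr eq1 -!scalemxAr diffE.
by rewrite scalerA divfK // subrr mulmx0.
Qed.

(** For [f] enumerating the indices other than [s], multiplication by [sel f]
    and by [dirac s] extracts the blocks of a matrix along that splitting. *)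
Definition sel k n (f : 'I_k -> 'I_n) : 'M[R]_(k, n) := rowsub f 1%:M.
Definition dirac n (s : 'I_n) : 'cV[R]_n := delta_mx s ord0.

Variables (k n : nat) (f : 'I_k -> 'I_n) (s : 'I_n).
Hypothesis f_inj : injective f.
Hypothesis f_neq : forall i, f i != s.
Hypothesis f_onto : forall j, j != s -> exists i, j = f i.

Local Notation J := (sel f).
Local Notation e := (dirac s).

Lemma mul_sel m (A : 'M[R]_(n, m)) : J *m A = rowsub f A.
Proof. by rewrite mul_rowsub_mx mul1mx. Qed.

Lemma mul_selT m (A : 'M[R]_(m, n)) : A *m J^T = colsub f A.
Proof.
rewrite -[LHS]trmxK trmx_mul trmxK mul_sel.
by apply/matrixP => i j; rewrite !mxE.
Qed.

Lemma mul_dirac m (A : 'M[R]_(m, n)) : A *m e = col s A.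
Proof. by rewrite -colE. Qed.

Lemma mul_diracT m (A : 'M[R]_(n, m)) : e^T *m A = row s A.
Proof. by rewrite trmx_delta -rowE. Qed.

Lemma sel_selT : J *m J^T = 1%:M.
Proof. by rewrite mul_sel; apply/matrixP => i j; rewrite !mxE (inj_eq f_inj) eq_sym. Qed.

Lemma sel_dirac : J *m e = 0.
Proof. by rewrite mul_sel; apply/matrixP => i j; rewrite !mxE (negPf (f_neq i)). Qed.

Lemma diracT_dirac : e^T *m e = 1%:M.
Proof. by rewrite mul_diracT; apply/matrixP => i j; rewrite !mxE !ord1 !eqxx. Qed.

Lemma sel_ext m (A B : 'M[R]_(n, m)) :
  J *m A = J *m B -> e^T *m A = e^T *m B -> A = B.
Proof.
rewrite !mul_sel !mul_diracT => /matrixP JAB /matrixP eAB; apply/matrixP => i j.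
have [->|/f_onto[i' ->]] := eqVneq i s; first by have := eAB ord0 j; rewrite !mxE.
by have := JAB i' j; rewrite !mxE.
Qed.

Lemma sel_partition : J^T *m J + e *m e^T = 1%:M.
Proof.
have eJ : e^T *m J^T = 0 by rewrite -trmx_mul sel_dirac trmx0.
apply: sel_ext; rewrite mulmxDr !mulmxA mulmx1.
  by rewrite sel_selT mul1mx sel_dirac mul0mx addr0.
by rewrite eJ mul0mx add0r diracT_dirac mul1mx.
Qed.

Lemma sel_ext2 (A B : 'M[R]_n) :
  J *m A *m J^T = J *m B *m J^T -> J *m A *m e = J *m B *m e ->
  e^T *m A *m J^T = e^T *m B *m J^T -> e^T *m A *m e = e^T *m B *m e -> A = B.
Proof.
have split_r m (C D : 'M[R]_(m, n)) :
    C *m J^T = D *m J^T -> C *m e = D *m e -> C = D.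
  move=> CJ Ce; rewrite -(mulmx1 C) -(mulmx1 D) -sel_partition !mulmxDr.
  by rewrite !mulmxA CJ Ce.
by move=> *; apply: sel_ext; apply: split_r.
Qed.

Lemma diag_sel_dirac (Om : 'M[R]_n) : is_diag_mx Om -> J *m Om *m e = 0.
Proof.
move=> /is_diag_mxP dO; rewrite mul_sel mul_dirac; apply/matrixP => i j.
by rewrite !mxE dO // f_neq.
Qed.

Lemma diag_dirac_sel (Om : 'M[R]_n) : is_diag_mx Om -> e^T *m Om *m J^T = 0.
Proof.
move=> dO; apply: trmx_inj; rewrite !trmx_mul !trmxK trmx0 mulmxA.
apply: diag_sel_dirac; apply/is_diag_mxP => i j ij; rewrite mxE.
by apply: (is_diag_mxP dO); rewrite eq_sym.
Qed.

Lemma model_eq_test a b (S L Om : 'M[R]_n) d (X : 'M[R]_(n, a)) (Y : 'M[R]_(n, b)) :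
  model_eq S L Om d ->
  ((1%:M - L) *m X)^T *m S *m ((1%:M - L) *m Y) =
    X^T *m Om *m Y + (X^T *m d) *m (d^T *m Y).
Proof.
rewrite /model_eq; move: (1%:M - L) => B /(congr1 (fun M => X^T *m M *m Y)).
by rewrite /= trmx_mul mulmxDr mulmxDl !mulmxA.
Qed.

Section Sink.
Variables (S L Om : 'M[R]_n) (d : 'cV[R]_n).
Hypothesis eqS : model_eq S L Om d.
Hypothesis dO : is_diag_mx Om.
Hypothesis eL : e^T *m L = 0.

Local Notation L' := (J *m L *m J^T).

Lemma sink_cols : (1%:M - L) *m J^T = J^T *m (1%:M - L').
Proof.
rewrite mulmxBl mulmxBr mul1mx mulmx1; congr (_ - _).
apply: sel_ext; first by rewrite !mulmxA sel_selT mul1mx.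
by rewrite !mulmxA eL -trmx_mul sel_dirac trmx0 !mul0mx.
Qed.

Lemma sink_col : (1%:M - L) *m e = e - J^T *m (J *m L *m e).
Proof.
rewrite mulmxBl mul1mx; congr (_ - _).
apply: sel_ext; first by rewrite !mulmxA sel_selT mul1mx.
by rewrite !mulmxA eL -trmx_mul sel_dirac trmx0 !mul0mx.
Qed.

Lemma sink_marginal :
  model_eq (J *m S *m J^T) L' (J *m Om *m J^T) (J *m d).
Proof.
have := model_eq_test J^T J^T eqS.
by rewrite /model_eq sink_cols !trmx_mul !trmxK !mulmxA. 
Qed.

Lemma sink_cross :
  (1%:M - L')^T *m (J *m S *m e - J *m S *m J^T *m (J *m L *m e)) =
    d s ord0 *: (J *m d).
Proof.
have := model_eq_test J^T e eqS.
rewrite sink_cols sink_col trmxK (diag_sel_dirac dO) add0r.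
rewrite (mx11_factor (J *m d)) trmx_mul trmxK.
have -> : (d^T *m e) ord0 ord0 = d s ord0 by rewrite mul_dirac !mxE.
by move=> <-; rewrite -!mulmxA !mulmxBr !mulmxA.
Qed.

Lemma sink_variance :
  Om s s = ((e - J^T *m (J *m L *m e))^T *m S *m (e - J^T *m (J *m L *m e)))
             ord0 ord0 - d s ord0 ^+ 2.
Proof.
have := model_eq_test e e eqS; rewrite sink_col => ->.
by rewrite !mul_dirac !mul_diracT mx11_factor !mxE; ring.
Qed.

End Sink.

Section Source.
Variables (S L Om : 'M[R]_n) (d : 'cV[R]_n).
Hypothesis eqS : model_eq S L Om d.
Hypothesis dO : is_diag_mx Om.
Hypothesis Le : L *m e = 0.

Local Notation L' := (J *m L *m J^T).
Local Notation l := (e^T *m L *m J^T)^T.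

Lemma source_col : (1%:M - L) *m e = e.
Proof. by rewrite mulmxBl mul1mx Le subr0. Qed.

Lemma source_cols : (1%:M - L) *m J^T = J^T *m (1%:M - L') - e *m l^T.
Proof.
have eJ : e^T *m J^T = 0 by rewrite -trmx_mul sel_dirac trmx0.
rewrite trmxK; apply: sel_ext.
  rewrite !mulmxBr !mulmxBl !mul1mx !mulmxBr !mulmxA mulmx1 sel_selT.
  by rewrite mul1mx sel_dirac !mul0mx subr0.
rewrite !mulmxBr !mulmxBl !mul1mx !mulmxBr !mulmxA eJ !mul0mx diracT_dirac.
by rewrite mul1mx subrr.
Qed.

Lemma source_variance : S s s = Om s s + d s ord0 ^+ 2.
Proof.
have := model_eq_test e e eqS; rewrite source_col.
rewrite !mul_dirac !mul_diracT => /matrixP/(_ ord0 ord0).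
by rewrite mx11_factor !mxE => ->; ring.
Qed.

Lemma source_cross :
  (1%:M - L')^T *m (J *m S *m e) = S s s *: l + d s ord0 *: (J *m d).
Proof.
have := model_eq_test J^T e eqS.
rewrite source_col source_cols (trmxK J) (diag_sel_dirac dO) add0r mx11_factor.
have -> : (d^T *m e) ord0 ord0 = d s ord0 by rewrite mul_dirac !mxE.
move: (1%:M - L') (l) => B m <-; rewrite linearB /= !trmx_mul !trmxK !mulmxBl.
rewrite -(mulmxA m) -(mulmxA m) mx11_factor.
have -> : (e^T *m S *m e) ord0 ord0 = S s s.
  by rewrite mul_diracT mul_dirac !mxE.
by rewrite addrC !mulmxA subrK.
Qed.

(** Conditioning on the source leaves the latent variance [Om s s / S s s], so
    [S s s] times the conditional covariance is again a point of the model on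
    the other nodes.  A common factor [a] rescales the noise variances by [a]
    and the latent loadings by its square root; [c ^ 2 = a * Om s s] lets the
    caller choose [a] so that no square root is left. *)
Lemma source_conditional a c : c ^+ 2 = a * Om s s ->
  model_eq (a *: (S s s *: (J *m S *m J^T) - (J *m S *m e) *m (e^T *m S *m J^T)))
           L' ((a * S s s) *: (J *m Om *m J^T)) (c *: (J *m d)).
Proof.
move=> cE; have cross := source_cross; have variance := source_variance.
set q := S s s in cross variance *; set de := d s ord0 in cross variance.
set D := J *m d in cross *; set u := J *m S *m e in cross *.
have crossT : e^T *m S *m J^T *m (1%:M - L') = q *: l^T + de *: D^T.
  have := model_eq_test e J^T eqS.
  rewrite source_col source_cols (diag_dirac_sel dO) add0r -(trmx_mul J d) -/D.
  have -> : e^T *m d = de%:M.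
    by rewrite mul_diracT [LHS]mx11_scalar mxE.
  move: (1%:M - L') (l) => B m; rewrite mul_scalar_mx => <-.
  rewrite mulmxBr !mulmxA.
  have -> : e^T *m S *m e = q%:M.
    by rewrite mul_diracT mul_dirac [LHS]mx11_scalar !mxE.
  by rewrite mul_scalar_mx addrC subrK.
have block := model_eq_test J^T J^T eqS.
rewrite source_cols (trmxK J) -/D -(trmx_mul J d) -/D in block.
rewrite /model_eq; move: (1%:M - L') (l) cross crossT block => B m cross crossT block.
have expand : (J^T *m B - e *m m^T)^T *m S *m (J^T *m B - e *m m^T)
    = B^T *m (J *m S *m J^T) *m B
      - (B^T *m u) *m m^T - m *m (e^T *m S *m J^T *m B)
      + q *: (m *m m^T).
  rewrite [(_ - _)^T]linearB /= !trmx_mul !trmxK !mulmxBl !mulmxBr !mulmxA.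
  have -> : m *m e^T *m S *m e = q *: m.
    by rewrite -!mulmxA mx11_factor mulmxA mul_diracT mul_dirac !mxE.
  by rewrite -scalemxAl opprD opprK !addrA.
rewrite expand cross crossT in block.
rewrite -[in LHS]scalemxAr -[in LHS]scalemxAl mulmxBr mulmxBl.
rewrite -[in LHS]scalemxAr -[in LHS]scalemxAl.
have -> w : B^T *m (u *m w) *m B = (B^T *m u) *m (w *m B) by rewrite !mulmxA.
rewrite cross crossT.
apply/matrixP => i j; have /matrixP/(_ i j) := block.
set X := B^T *m (J *m S *m J^T) *m B.
set O' := J *m Om *m J^T.
have {}cE : c * c = a * (q - de * de) by rewrite -expr2 cE variance; ring.
move: X O' (D) => X O' z; rewrite !mxE !big_ord1 !mxE => bij.
apply/subr0_eq; set x := m i ord0 in bij *; set y := m j ord0 in bij *.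
set p := z i ord0 in bij *; set r := z j ord0 in bij *.
(* [a * q] times the equation [block] and [p * r] times [cE], entrywise. *)
transitivity (a * q * (X i j - (q * x + de * p) * y - x * (q * y + de * r)
  + q * (x * y) - (O' i j + p * r)) - (c * c - a * (q - de * de)) * (p * r)).
  by ring.
by rewrite bij cE !subrr mulr0 mul0r subrr.
Qed.

End Source.

End ModelEquation.

(** * Deleting a node of the graph *)

Section DeleteNode.
Variables (R : realType) (V : finType) (E : rel V) (s : V).

Local Notation V' := {v : V | v \in (~: [set s])%SET}.
Local Notation E' := (induced_subgraph E (~: [set s])%SET).

Definition skip (i : 'I_#|{: V'}|) : 'I_#|V| := enum_rank (val (enum_val i)).

Lemma skip_inj : injective skip.
Proof. by move=> i j /enum_rank_inj/val_inj/enum_val_inj. Qed.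

Lemma skip_neq i : skip i != enum_rank s.
Proof.
rewrite (inj_eq enum_rank_inj); have := valP (enum_val i).
by rewrite !inE.
Qed.

Lemma skip_onto j : j != enum_rank s -> exists i, j = skip i.
Proof.
move=> js; have js' : enum_val j \in (~: [set s])%SET.
  by rewrite !inE; apply: contraNneq js => <-; rewrite enum_valK.
exists (enum_rank (Sub (enum_val j) js' : V')).
by rewrite /skip enum_rankK SubK enum_valK.
Qed.

Lemma skip_node v : v != s -> exists i, skip i = enum_rank v.
Proof. by rewrite -(inj_eq enum_rank_inj) => /skip_onto[i ->]; exists i. Qed.

Lemma acyclic_induced : acyclic E -> acyclic E'.
Proof.
move=> acE c cyc; have /acE : cycle E (map val c) by rewrite cycle_map.
by case: c cyc.
Qed.

Local Notation J := (@sel R _ _ skip).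
Local Notation e := (@dirac R _ (enum_rank s)).

Lemma sel_entry (A : 'M[R]_#|V|) i j : (J *m A *m J^T) i j = A (skip i) (skip j).
Proof. by rewrite mul_selT mul_sel !mxE. Qed.

Lemma sel_entry1 (d : 'cV[R]_#|V|) i : (J *m d) i ord0 = d (skip i) ord0.
Proof. by rewrite mul_sel mxE. Qed.

Lemma R_E_induced (L : 'M[R]_#|V|) : R_E E L -> R_E E' (J *m L *m J^T).
Proof.
move=> LE w v nwv; rewrite sel_entry /skip !enum_rankK; exact: LE.
Qed.

Lemma diag_pos_induced (Om : 'M[R]_#|V|) a :
  0 < a -> diag_pos Om -> diag_pos (a *: (J *m Om *m J^T)).
Proof.
move=> a0 [/is_diag_mxP dO pO]; split=> [|i].
  apply/is_diag_mxP => i j ij; rewrite mxE sel_entry dO ?mulr0 //.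
  by rewrite val_eqE (inj_eq skip_inj).
by rewrite mxE sel_entry mulr_gt0.
Qed.

(** Every parameter of the smaller graph, positive or not, is the restriction
    of one of the larger graph; the normalisation at [s] makes the rescaling
    used for a source trivial. *)
Lemma restriction_onto (L' Om' : 'M[R]_#|{: V'}|) (d' : 'cV[R]_#|{: V'}|) :
  R_E E' L' -> is_diag_mx Om' ->
  exists x : 'rV[R]_#|{: param_index E}|, exists L Om d,
    [/\ of_coord x = (L, Om, d), J *m L *m J^T = L', J *m Om *m J^T = Om',
        J *m d = d' & Om (enum_rank s) (enum_rank s) = 1 /\
        d (enum_rank s) ord0 = 0].
Proof.
move=> LE' /is_diag_mxP dO'.
have JJ := sel_selT R skip_inj; have Je := sel_dirac R skip_neq.
have ee := @diracT_dirac R _ (enum_rank s).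
have eJ : e^T *m J^T = 0 by rewrite -trmx_mul Je trmx0.
pose L := J^T *m L' *m J; pose Om := J^T *m Om' *m J + e *m e^T.
have JL : J *m L *m J^T = L'.
  by rewrite /L !mulmxA JJ mul1mx -mulmxA JJ mulmx1.
have JOm : J *m Om *m J^T = Om'.
  rewrite /Om mulmxDr mulmxDl !mulmxA JJ mul1mx -mulmxA JJ mulmx1.
  by rewrite Je !mul0mx addr0.
have eL : e^T *m L = 0 by rewrite /L !mulmxA eJ !mul0mx.
have Le : L *m e = 0 by rewrite /L -!mulmxA Je !mulmx0.
have eOm : e^T *m Om = e^T.
  by rewrite /Om mulmxDr !mulmxA eJ !mul0mx ee mul1mx add0r.
have Ome : Om *m e = e.
  by rewrite /Om mulmxDl -!mulmxA Je !mulmx0 ee mulmx1 add0r.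
have ed : e^T *m (J^T *m d') = 0 by rewrite mulmxA eJ mul0mx.
have Jd : J *m (J^T *m d') = d' by rewrite mulmxA JJ mul1mx.
move: L Om (J^T *m d') JL JOm Jd eL Le eOm Ome ed.
move=> L Om d JL JOm Jd eL Le eOm Ome ed; exists (coord E (L, Om, d)), L, Om, d.
split=> //.
  apply: coordK.
    move=> w v nwv; have [->|/skip_node[i iw]] := eqVneq w s.
      by have /matrixP/(_ ord0 (enum_rank v)) := eL; rewrite mul_diracT !mxE.
    have [->|/skip_node[j jv]] := eqVneq v s.
      by have /matrixP/(_ (enum_rank w) ord0) := Le; rewrite mul_dirac !mxE.
    rewrite -iw -jv -sel_entry JL -(enum_valK i) -(enum_valK j); apply: LE'.
    move: nwv iw jv; rewrite /skip /induced_subgraph => nwv.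
    by move=> /enum_rank_inj -> /enum_rank_inj ->.
  apply/is_diag_mxP => i j; rewrite val_eqE => ij.
  have [iS|/skip_onto[i' iE]] := eqVneq i (enum_rank s).
    have /matrixP/(_ ord0 j) := eOm; rewrite mul_diracT !mxE -iS => ->.
    by rewrite eq_sym (negPf ij).
  have [jS|/skip_onto[j' jE]] := eqVneq j (enum_rank s).
    have /matrixP/(_ i ord0) := Ome; rewrite mul_dirac !mxE -jS => ->.
    by rewrite (negPf ij).
  rewrite iE jE -sel_entry JOm dO' // val_eqE.
  by apply: contraNneq ij => ij'; rewrite iE jE ij'.
split.
  have /matrixP/(_ ord0 ord0) : e^T *m Om *m e = 1%:M by rewrite eOm ee.
  by rewrite mul_diracT mul_dirac !mxE.
by have /matrixP/(_ ord0 ord0) := ed; rewrite mul_diracT !mxE.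
Qed.

End DeleteNode.

(** * Adding a sink *)

Section AddSink.
Variables (R : realType) (V : finType) (E : rel V) (s v : V).
Hypotheses (acyclicE : acyclic E) (sink_s : sink E s).
Hypotheses (neq_vs : v != s) (nEvs : ~~ E v s).

Local Notation E' := (induced_subgraph E (~: [set s])%SET).
Local Notation J := (@sel R _ _ (@skip V s)).
Local Notation e := (@dirac R _ (enum_rank s)).

Let sI := @skip_inj V s.
Let sN := @skip_neq V s.
Let sO := @skip_onto V s.

Lemma sink_row (L : 'M[R]_#|V|) : R_E E L -> e^T *m L = 0.
Proof.
move=> LE; rewrite mul_diracT; apply/matrixP => i j; rewrite !mxE.
by rewrite -(enum_valK j) LE //; apply/negP => Es; apply: sink_s; exists (enum_val j).
Qed.

(** The generic condition asks that the restricted parameter be generic for the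
    smaller model, that [s] load on the latent variable, and that the regression
    of the latent variable on the nodes other than [s] involve the non-parent
    [v]. *)
Theorem sink_identifiable :
  generically_finitely_identifiable R E' ->
  generically_finitely_identifiable R E.
Proof.
move=> /identifiableP[g' [Pg' [x0' g'x0] fin]].
have [iv ivE] := skip_node neq_vs; have acE' := acyclic_induced (s := s) acyclicE.
pose rL (x : 'rV[R]_#|{: param_index E}|) := J *m (of_coord x).1.1 *m J^T.
pose rOm (x : 'rV[R]_#|{: param_index E}|) := J *m (of_coord x).1.2 *m J^T.
pose rd (x : 'rV[R]_#|{: param_index E}|) := J *m (of_coord x).2.
pose g1 x := g' (coord E' (rL x, rOm x, rd x)).
pose g2 x := ((1%:M - rL x) *m \adj (rOm x) *m rd x) iv ord0.
pose g3 (x : 'rV[R]_#|{: param_index E}|) := (of_coord x).2 (enum_rank s) ord0.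
have PL : polymx rL.
  apply: polymxM (polymx_cst _ _); apply: polymxM (polymx_cst _ _) _.
  exact: polymx_of_coord1.
have POm : polymx rOm.
  apply: polymxM (polymx_cst _ _); apply: polymxM (polymx_cst _ _) _.
  exact: polymx_of_coord2.
have Pd : polymx rd.
  apply: polymxM (polymx_cst _ _) _; exact: polymx_of_coord3.
have Pg1 : polyfun g1 by apply: polyfun_coords.
have Pg2 : polyfun g2.
  suff Pm : polymx (fun x => (1%:M - rL x) *m \adj (rOm x) *m rd x) by exact: Pm.
  apply: (polymxM _ Pd); apply: (polymxM _ (polymx_adj POm)).
  by apply: polymxD (polymx_cst _ _) _; exact: polymxN.
have Pg3 : polyfun g3 by exact: polymx_of_coord3.
have g1_neq0 : exists x, g1 x != 0.
  case xE: (of_coord x0') => [[L0 Om0] d0].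
  have [] := @restriction_onto R V E s L0 Om0 d0.
  - move=> w u nwu; have := congr1 (fun t => t.1.1) xE => /= <-.
    by rewrite mxE !enum_rankK insubN.
  - by have := congr1 (fun t => t.1.2) xE => /= <-; exact: diag_mx_is_diag.
  move=> x [L [Om [d [xLd JL JOm Jd _]]]]; exists x.
  by rewrite /g1 /rL /rOm /rd xLd /= JL JOm Jd -xE of_coordK.
have g2_neq0 : exists x, g2 x != 0.
  have [] := @restriction_onto R V E s 0 1%:M (delta_mx iv ord0).
  - by move=> w u _; rewrite mxE.
  - exact: scalar_mx_is_diag.
  move=> x [L [Om [d [xLd JL JOm Jd _]]]]; exists x.
  rewrite /g2 /rL /rOm /rd xLd /= JL JOm Jd subr0 adj1 !mul1mx mxE !eqxx.
  exact: oner_neq0.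
have g3_neq0 : exists x, g3 x != 0.
  exists (coord E (0, 1%:M, e)); rewrite /g3 coordK.
  - by rewrite mxE !eqxx oner_neq0.
  - by move=> w u _; rewrite mxE.
  - exact: scalar_mx_is_diag.
apply/identifiableP; exists (fun x => g1 x * (g2 x * g3 x)); split.
- by do 2?[apply: polyfunM => //].
- by apply: polyfunM_neq0 => //; [exact: polyfunM|exact: polyfunM_neq0].
move=> x; rewrite !mulf_eq0 !negb_or => Tx /and3P[g1x g2x g3x].
move: g1x g2x g3x Tx; rewrite /g1 /g2 /g3 /rL /rOm /rd.
case: (of_coord x) => [[L0 Om0] d0] /= g1x g2x d0s [[LE0 dp0] _].
have dp1 (Om : 'M[R]_#|V|) : diag_pos Om -> diag_pos (J *m Om *m J^T).
  by move=> dp; rewrite -[X in diag_pos X]scale1r; exact: diag_pos_induced.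
have [dO0 pO0] := dp1 _ dp0; have LE0' := R_E_induced (s := s) LE0.
set S := phi (L0, Om0, d0).
have modelE L Om d : R_E E L -> diag_pos Om -> phi (L, Om, d) = S ->
    model_eq (J *m S *m J^T) (J *m L *m J^T) (J *m Om *m J^T) (J *m d).
  move=> LE [dO _] /(phiP acyclicE _ _ _ LE) eqS.
  exact: (sink_marginal sI sN sO eqS (sink_row LE)).
have crossE L Om d : R_E E L -> diag_pos Om -> phi (L, Om, d) = S ->
    (1%:M - J *m L *m J^T)^T *m (J *m S *m e - J *m S *m J^T *m (J *m L *m e)) =
    d (enum_rank s) ord0 *: (J *m d).
  move=> LE [dO _] /(phiP acyclicE _ _ _ LE) eqS.
  exact: (sink_cross sI sN sO eqS dO (sink_row LE)).
have l_v L : R_E E L -> (J *m L *m e) iv ord0 = 0.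
  by move=> LE; rewrite mul_dirac mul_sel !mxE ivE; exact: LE.
have nreg : forall mu : 'cV[R]_ _, mu iv ord0 = 0 ->
    J *m S *m e <> J *m S *m J^T *m mu.
  move=> mu; apply: sink_not_regression (crossE _ _ _ LE0 dp0 erefl) g2x => //.
  - exact: modelE.
  - exact: unitmx_1B acE' _ LE0'.
  - exact: l_v.
have phi'E L Om d : R_E E L -> diag_pos Om -> phi (L, Om, d) = S ->
    phi (J *m L *m J^T, J *m Om *m J^T, J *m d) = J *m S *m J^T.
  by move=> LE dp /(modelE _ _ _ LE dp) eqS; apply/(phiP acE' _ _ _ (R_E_induced LE)).
have coordE := coordK (J *m d0) LE0' dO0.
have /fin := g1x; rewrite coordE phi'E // => /(_ _) finB.
pose restrict (t : 'M[R]_#|V| * 'M[R]_#|V| * 'cV[R]_#|V|) :=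
  (J *m t.1.1 *m J^T, J *m t.1.2 *m J^T, J *m t.2).
apply: (finite_set_inj (f := restrict)).
- by apply: finB; split=> //; split.
- move=> [[L Om] d] [[[LE dp] _] eqS]; split; last exact: phi'E.
  by split=> //; split; [exact: R_E_induced|exact: dp1].
move=> [[L1 Om1] d1] [[L2 Om2] d2] [[[LE1 dp1'] _] eqS1] [[[LE2 dp2] _] eqS2].
rewrite /restrict /= in LE1 LE2 dp1' dp2 * => -[eqL eqOm eqd].
have [dO pO] := dp1 _ dp1'; have LE1' := R_E_induced (s := s) LE1.
have cross1 := crossE _ _ _ LE1 dp1' eqS1.
have := crossE _ _ _ LE2 dp2 eqS2; rewrite -eqL -eqd => cross2.
have [eql eqds] := sink_solution_unique (modelE _ _ _ LE1 dp1' eqS1)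
  (unitmx_1B acE' LE1') dO pO (l_v _ LE1) (l_v _ LE2) cross1 cross2 nreg.
have {}eqS1 := (phiP acyclicE _ _ _ LE1).1 eqS1.
have {}eqS2 := (phiP acyclicE _ _ _ LE2).1 eqS2.
congr (_, _, _).
- by apply: (sel_ext2 sI sN sO eqL eql); rewrite !sink_row // !mul0mx.
- apply: (sel_ext2 sI sN sO eqOm).
  + by rewrite !(diag_sel_dirac sN) ?dp1'.1 ?dp2.1.
  + by rewrite !(diag_dirac_sel sN) ?dp1'.1 ?dp2.1.
  + rewrite !mul_diracT !mul_dirac; apply/matrixP => i j; rewrite !mxE.
    rewrite (sink_variance sI sN sO eqS1 (sink_row LE1)).
    by rewrite (sink_variance sI sN sO eqS2 (sink_row LE2)) eql eqds.
- apply: (sel_ext sO eqd); rewrite !mul_diracT.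
  by apply/matrixP => i j; rewrite !mxE (ord1 j).
Qed.

End AddSink.

(** * Adding a source *)

Section AddSource.
Variables (R : realType) (V : finType) (E : rel V) (s v : V).
Hypotheses (acyclicE : acyclic E) (source_s : source E s).
Hypotheses (neq_vs : v != s) (nEsv : ~~ E s v).

Local Notation E' := (induced_subgraph E (~: [set s])%SET).
Local Notation J := (@sel R _ _ (@skip V s)).
Local Notation e := (@dirac R _ (enum_rank s)).

Let sI := @skip_inj V s.
Let sN := @skip_neq V s.
Let sO := @skip_onto V s.

Lemma source_column (L : 'M[R]_#|V|) : R_E E L -> L *m e = 0.
Proof.
move=> LE; rewrite mul_dirac; apply/matrixP => i j; rewrite !mxE.
by rewrite -(enum_valK i) LE //; apply/negP => Es; apply: source_s; exists (enum_val i).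
Qed.

(** The determinant of this matrix is the minor of [S] with rows [pa v] and [s]
    and columns [pa v] and [v], which vanishes when [s] and [v] are independent
    given [pa v]: row [v] carries the row [s] of [S], and identity rows at the
    other nodes stand in for the choice of columns. *)
Definition pa_minor (S : 'M[R]_#|V|) : 'M[R]_#|V| :=
  \matrix_(i, j) if E (enum_val i) v then S i j
                 else if i == enum_rank v then S (enum_rank s) j
                 else (i == j)%:R.

Lemma pa_minor_det0 (S : 'M[R]_#|V|) (x : 'cV[R]_#|V|) :
  x != 0 ->
  (forall i, E (enum_val i) v -> (S *m x) i ord0 = 0) ->
  (S *m x) (enum_rank s) ord0 = 0 ->
  (forall i, ~~ E (enum_val i) v -> i != enum_rank v -> x i ord0 = 0) ->
  \det (pa_minor S) = 0.
Proof.
move=> x0 Spa Ss xsupp; apply/eqP; rewrite -det_tr; apply/det0P.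
exists x^T; first by rewrite -(inj_eq trmx_inj) trmxK trmx0.
apply: trmx_inj; rewrite trmx_mul !trmxK trmx0; apply/colP => i.
rewrite [LHS]mxE [RHS]mxE; under eq_bigr do rewrite mxE.
case Ei: (E (enum_val i) v); first by have := Spa i Ei; rewrite mxE.
have [iv|niv] := eqVneq i (enum_rank v); first by rewrite -[RHS]Ss mxE.
rewrite (bigD1 i) //= eqxx mul1r xsupp ?Ei // add0r big1 // => j ji.
by rewrite eq_sym (negPf ji) mul0r.
Qed.

(** If [v] does not load on the latent variable, then what remains of [v] after
    subtracting its parents is its own noise, which is correlated only with
    [v] and its descendants: not with a parent, as the graph is acyclic, and not
    with the source [s]. *)
Lemma regression_residual (S L Om : 'M[R]_#|V|) (d : 'cV[R]_#|V|) u :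
  R_E E L -> is_diag_mx Om -> model_eq S L Om d ->
  d (enum_rank v) ord0 = 0 -> E u v || (u == s) ->
  (S *m col (enum_rank v) (1%:M - L)) (enum_rank u) ord0 = 0.
Proof.
move=> LE /is_diag_mxP dO eqS dv uP.
set y := S *m _.
have yE w : w != v -> (y^T *m (1%:M - L)) ord0 (enum_rank w) = 0.
  move=> wv; rewrite -[y^T *m _]trmxK trmx_mul trmxK mxE.
  rewrite /y colE !mulmxA eqS -colE !mxE dO ?add0r; last first.
    by rewrite val_eqE (inj_eq enum_rank_inj).
  by rewrite big_ord1 !mxE dv mulr0.
have cs (D : pred V) : (forall a b, D a -> E a b -> D b) -> D v -> ~~ D u ->
    y (enum_rank u) ord0 = 0.
  move=> Dcl Dv nDu; rewrite -[LHS](mxE tt (fun i j => y j i)).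
  have := closed_support acyclicE LE Dcl (x := y^T) _ nDu; rewrite !mxE; apply.
  by move=> w nDw; apply: yE; apply: contraNneq nDw => ->.
case/orP: uP => [Euv|/eqP us].
  apply: (cs (connect E v)) => //=.
    by move=> a b /connect_trans cab Eab; apply: cab; exact: connect1.
  by apply/negP; exact: acyclic_connectF.
apply: (cs (predC1 s)) => //=; last by rewrite us eqxx.
by move=> a b _ Eab; apply/eqP => bs; apply: source_s; exists a; rewrite -bs.
Qed.

(** The column of [1 - L] at [v], with entry [1] at [v] and minus the weights at
    the parents, is a null vector. *)
Lemma pa_minor_vanishes (S L Om : 'M[R]_#|V|) (d : 'cV[R]_#|V|) a :
  R_E E L -> is_diag_mx Om -> model_eq S L Om d ->
  d (enum_rank v) ord0 = 0 -> \det (pa_minor (a *: S)) = 0.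
Proof.
move=> LE dO eqS dv.
have Lvv : L (enum_rank v) (enum_rank v) = 0.
  by apply: LE; apply/negP => /acyclic_connectF; apply=> //; exact: connect0.
apply: (@pa_minor_det0 _ (col (enum_rank v) (1%:M - L))).
- apply: contra_neq (@oner_neq0 R) => /colP/(_ (enum_rank v)).
  by rewrite !mxE eqxx Lvv subr0.
- move=> i Ei; rewrite -scalemxAl mxE -(enum_valK i).
  by rewrite (regression_residual LE dO eqS dv) ?mulr0 // Ei.
- by rewrite -scalemxAl mxE (regression_residual LE dO eqS dv) ?mulr0 // eqxx orbT.
- by move=> i nEi iv; rewrite !mxE (negPf iv) -(enum_valK i) LE // subrr.
Qed.

(** The covariance with its denominator cleared. *)
Definition adj_cov (L Om : 'M[R]_#|V|) (d : 'cV[R]_#|V|) : 'M[R]_#|V| :=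
  (\adj (1%:M - L))^T *m (Om + d *m d^T) *m \adj (1%:M - L).

Lemma adj_covE (S L Om : 'M[R]_#|V|) (d : 'cV[R]_#|V|) :
  model_eq S L Om d -> adj_cov L Om d = \det (1%:M - L) ^+ 2 *: S.
Proof.
rewrite /adj_cov => <-; move: (1%:M - L) => B.
rewrite !mulmxA -trmx_mul mul_mx_adj -mulmxA mul_mx_adj tr_scalar_mx.
by rewrite mul_scalar_mx mul_mx_scalar scalerA expr2.
Qed.

(** Nonvanishing may be witnessed outside the positive parameters: with no edge
    weights and loadings only at [s] and [v], the value [-1] of [Om] at [s]
    cancels the variance of [s], and the minor becomes the identity matrix. *)
Lemma pa_minor_neq0 : exists x : 'rV[R]_#|{: param_index E}|,
  \det (pa_minor (adj_cov (of_coord x).1.1 (of_coord x).1.2 (of_coord x).2)) != 0.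
Proof.
pose Om : 'M[R]_#|V| := diag_mx (\row_i if i == enum_rank s then -1 else 1).
pose d : 'cV[R]_#|V| := \col_i ((i == enum_rank s) || (i == enum_rank v))%:R.
have LE : R_E E (0 : 'M[R]_#|V|) by move=> w u _; rewrite mxE.
exists (coord E (0, Om, d)); rewrite coordK //; last exact: diag_mx_is_diag.
suff -> : pa_minor (adj_cov 0 Om d) = 1%:M by rewrite det1 oner_neq0.
rewrite /adj_cov subr0 adj1 trmx1 mul1mx mulmx1.
have rank_vs : (enum_rank v == enum_rank s) = false.
  by rewrite (inj_eq enum_rank_inj) (negPf neq_vs).
apply/matrixP => i j; rewrite [LHS]mxE [RHS]mxE.
case Ei: (E (enum_val i) v).
  have ns : (i == enum_rank s) = false.
    by apply: contraTF Ei => /eqP ->; rewrite enum_rankK.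
  have nv : (i == enum_rank v) = false.
    apply: contraTF Ei => /eqP ->; rewrite enum_rankK.
    by apply/negP => /acyclic_connectF; apply=> //; exact: connect0.
  by rewrite !mxE big_ord1 !mxE ns nv mul0r addr0.
have [->|//] := eqVneq i (enum_rank v).
rewrite !mxE big_ord1 !mxE eqxx /= mul1r (eq_sym _ j) (eq_sym _ j).
have [->|_] := eqVneq j (enum_rank s).
  by rewrite (eq_sym (enum_rank s)) rank_vs mulr1n addNr.
by rewrite mulr0n add0r.
Qed.

(** Squaring the third equation gives [w_i * a_i ^ 2], squaring the second gives
    [d_i ^ 2 * a_i ^ 2]; their sum is the known number [w_i + d_i ^ 2] times
    [a_i ^ 2], so [a_i ^ 2] is determined, and then [w_i] and [d_i ^ 2]. *)
Lemma sqrt_scale_inj (w0 w1 w2 d1 d2 a1 a2 : R) :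
  0 < w0 -> 0 < w1 -> 0 < w2 -> w1 + d1 ^+ 2 = w2 + d2 ^+ 2 ->
  d1 * a1 = d2 * a2 -> Num.sqrt (w0 * w1) * a1 = Num.sqrt (w0 * w2) * a2 ->
  a1 != 0 -> (0 <= d1) = (0 <= d2) -> w1 = w2 /\ d1 = d2.
Proof.
move=> w00 w10 w20 eqq eqda eqwa a10 sgn.
have eqwa2 : w1 * a1 ^+ 2 = w2 * a2 ^+ 2.
  have := congr1 (fun x => x ^+ 2) eqwa; rewrite /= !exprMn !sqr_sqrtr; last 2 first.
  - by rewrite ltW ?mulr_gt0.
  - by rewrite ltW ?mulr_gt0.
  by rewrite -!mulrA => /(mulfI (lt0r_neq0 w00)).
have q0 : w1 + d1 ^+ 2 != 0 by rewrite lt0r_neq0 // ltr_wpDr ?sqr_ge0.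
have eqa2 : a1 ^+ 2 = a2 ^+ 2.
  apply: (mulfI q0); rewrite {2}eqq !mulrDl eqwa2 -!exprMn eqda //.
have eqw : w1 = w2.
  apply: (mulIf (_ : a1 ^+ 2 != 0)); first by rewrite expf_neq0.
  by rewrite eqwa2 eqa2.
split=> //; have /eqP : d1 ^+ 2 = d2 ^+ 2 by apply: (addrI w1); rewrite eqq eqw.
rewrite eqf_sqr => /orP[/eqP //|/eqP dN]; move: sgn; rewrite dN oppr_ge0.
case: (ltrgtP d2 0) => // d20 _; by rewrite d20 oppr0.
Qed.

(** The smaller parameter built from a generic one is rescaled by
    [a = Om s s] in [source_conditional], which makes it polynomial.  The other
    points of the fiber are rescaled by the same [a], so that they land in the
    same smaller fiber, at the price of a square root there; the sign of the
    loading of [s] is recorded separately. *)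
Theorem source_identifiable :
  generically_finitely_identifiable R E' ->
  generically_finitely_identifiable R E.
Proof.
move=> /identifiableP[g' [Pg' [x0' g'x0] fin]].
have [iv ivE] := skip_node neq_vs; have acE' := acyclic_induced (s := s) acyclicE.
pose L_ (x : 'rV[R]_#|{: param_index E}|) := (of_coord x).1.1.
pose Om_ (x : 'rV[R]_#|{: param_index E}|) := (of_coord x).1.2.
pose d_ (x : 'rV[R]_#|{: param_index E}|) := (of_coord x).2.
pose w_ x := Om_ x (enum_rank s) (enum_rank s).
pose q_ x := w_ x + d_ x (enum_rank s) ord0 ^+ 2.
pose g1 x := g' (coord E' (J *m L_ x *m J^T,
  (w_ x * q_ x) *: (J *m Om_ x *m J^T), w_ x *: (J *m d_ x))).
pose g2 x := \det (pa_minor (adj_cov (L_ x) (Om_ x) (d_ x))).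
have PL : polymx L_ by exact: polymx_of_coord1.
have POm : polymx Om_ by exact: polymx_of_coord2.
have Pd : polymx d_ by exact: polymx_of_coord3.
have Pw : polyfun w_ by exact: POm.
have Pq : polyfun q_ by apply: polyfunD => //; apply: polyfunM; exact: Pd.
have Pg1 : polyfun g1.
  apply: polyfun_coords => //=.
  - apply: polymxM (polymx_cst _ _); exact: polymxM (polymx_cst _ _) PL.
  - apply: polymxZ; first exact: polyfunM.
    apply: polymxM (polymx_cst _ _); exact: polymxM (polymx_cst _ _) POm.
  - apply: polymxZ => //; exact: polymxM (polymx_cst _ _) Pd.
have Pg2 : polyfun g2.
  have PB : polymx (fun x => 1%:M - L_ x).
    by apply: polymxD (polymx_cst _ _) _; exact: polymxN.
  have PS : polymx (fun x => adj_cov (L_ x) (Om_ x) (d_ x)).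
    apply: polymxM (polymx_adj PB); apply: polymxM.
      exact: polymx_tr (polymx_adj PB).
    apply: polymxD => //; apply: polymxM => //; exact: polymx_tr.
  apply: polyfun_det => i j; case Ei: (E (enum_val i) v).
    by apply: (eq_polyfun _ (PS i j)) => x; rewrite [RHS]mxE Ei.
  have [iE|niE] := eqVneq i (enum_rank v).
    by apply: (eq_polyfun _ (PS (enum_rank s) j)) => x; rewrite [RHS]mxE Ei iE eqxx.
  apply: (eq_polyfun _ (polyfun_cst _ ((i == j)%:R))) => x.
  by rewrite [RHS]mxE Ei (negPf niE).
have g1_neq0 : exists x, g1 x != 0.
  case xE: (of_coord x0') => [[L0 Om0] d0].
  have [] := @restriction_onto R V E s L0 Om0 d0.
  - move=> w u nwu; have := congr1 (fun t => t.1.1) xE => /= <-.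
    by rewrite mxE !enum_rankK insubN.
  - by have := congr1 (fun t => t.1.2) xE => /= <-; exact: diag_mx_is_diag.
  move=> x [L [Om [d [xLd JL JOm Jd [wE dE]]]]]; exists x.
  rewrite /g1 /q_ /w_ /L_ /Om_ /d_ xLd /= wE dE expr0n addr0 mulr1 !scale1r.
  by rewrite JL JOm Jd -xE of_coordK.
apply/identifiableP; exists (fun x => g1 x * g2 x); split.
- exact: polyfunM.
- by apply: polyfunM_neq0 => //; exact: pa_minor_neq0.
move=> x; rewrite mulf_eq0 negb_or => Tx /andP[g1x g2x].
move: g1x g2x Tx; rewrite /g1 /g2 /q_ /w_ /L_ /Om_ /d_.
case: (of_coord x) => [[L0 Om0] d0] /= g1x g2x [[/= LE0 dp0] _].
set S := phi (L0, Om0, d0).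
have modelE L Om d : R_E E L -> phi (L, Om, d) = S -> model_eq S L Om d.
  by move=> LE /(phiP acyclicE _ _ _ LE).
have eqS0 := modelE _ _ _ LE0 erefl.
(* The minor only depends on the covariance matrix, so its nonvanishing at one
   point of a fiber constrains the whole fiber. *)
have d_v L Om d : R_E E L -> diag_pos Om -> phi (L, Om, d) = S ->
    d (enum_rank v) ord0 != 0.
  move=> LE [dO _] /(modelE _ _ _ LE) eqS; apply: contraNneq g2x => dv.
  by rewrite (adj_covE eqS0) (pa_minor_vanishes _ LE dO eqS dv).
set w0 := Om0 (enum_rank s) (enum_rank s) in g1x.
have w0_gt0 : 0 < w0 by exact: dp0.2.
set q := S (enum_rank s) (enum_rank s).
have qE L Om d : R_E E L -> phi (L, Om, d) = S ->
    q = Om (enum_rank s) (enum_rank s) + d (enum_rank s) ord0 ^+ 2.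
  by move=> LE /(modelE _ _ _ LE)/source_variance; apply; exact: source_column.
have q_gt0 : 0 < q.
  by rewrite (qE _ _ _ LE0 erefl) ltr_wpDr ?sqr_ge0 //; exact: dp0.2.
pose T := w0 *: (q *: (J *m S *m J^T) - (J *m S *m e) *m (e^T *m S *m J^T)).
have phi'E L Om d c : R_E E L -> diag_pos Om -> phi (L, Om, d) = S ->
    c ^+ 2 = w0 * Om (enum_rank s) (enum_rank s) ->
    phi (J *m L *m J^T, (w0 * q) *: (J *m Om *m J^T), c *: (J *m d)) = T.
  move=> LE [dO _] /(modelE _ _ _ LE) eqS cE.
  apply/(phiP acE' _ _ _ (R_E_induced LE)).
  exact: (source_conditional sI sN sO eqS dO (source_column LE) cE).
have Theta'E L Om (d : 'cV[R]_#|_|) : R_E E L -> diag_pos Om ->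
    Theta E' (J *m L *m J^T, (w0 * q) *: (J *m Om *m J^T), d).
  move=> LE dp; split=> //; split; first exact: R_E_induced.
  by apply: diag_pos_induced => //; exact: mulr_gt0.
have base := Theta'E _ _ (w0 *: (J *m d0)) LE0 dp0.
rewrite -(qE _ _ _ LE0 erefl) in g1x.
have coordE := coordK (w0 *: (J *m d0)) base.1.1 base.1.2.1.
have /fin := g1x; rewrite coordE phi'E ?expr2 // => /(_ base) finB.
pose F (t : 'M[R]_#|V| * 'M[R]_#|V| * 'cV[R]_#|V|) :=
  ((J *m t.1.1 *m J^T, (w0 * q) *: (J *m t.1.2 *m J^T),
    Num.sqrt (w0 * t.1.2 (enum_rank s) (enum_rank s)) *: (J *m t.2)),
   0 <= t.2 (enum_rank s) ord0).
apply: (finite_set_inj (f := F) (finite_setX finB (@finite_finset _ [set: bool]))).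
  move=> [[L Om] d] [[[/= LE dp] _] eqS]; split=> //; split; first exact: Theta'E.
  by apply: phi'E => //; rewrite sqr_sqrtr // ltW // mulr_gt0 //; exact: dp.2.
move=> [[L1 Om1] d1] [[L2 Om2] d2] [[[/= LE1 dp1] _] eqS1] [[[/= LE2 dp2] _] eqS2].
rewrite /F /= => -[eqL eqOm eqd sgn].
have M1 := modelE _ _ _ LE1 eqS1; have M2 := modelE _ _ _ LE2 eqS2.
have cross1 := source_cross sI sN sO M1 dp1.1 (source_column LE1).
have := source_cross sI sN sO M2 dp2.1 (source_column LE2).
rewrite -eqL cross1 -/q => eqcross.
have l_v L : R_E E L -> (e^T *m L *m J^T)^T iv ord0 = 0.
  by move=> LE; rewrite mxE mul_selT mul_diracT !mxE ivE; exact: LE.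
have Jd_v (d : 'cV[R]_#|V|) : (J *m d) iv ord0 = d (enum_rank v) ord0.
  by rewrite sel_entry1 ivE.
have lincomb m (b c : R) (y z : 'cV[R]_m) i :
    (b *: y + c *: z) i ord0 = b * y i ord0 + c * z i ord0 by rewrite !mxE.
have [eqw eqds] : Om1 (enum_rank s) (enum_rank s) = Om2 (enum_rank s) (enum_rank s) /\
    d1 (enum_rank s) ord0 = d2 (enum_rank s) ord0.
  apply: (sqrt_scale_inj (a2 := d2 (enum_rank v) ord0) w0_gt0 (dp1.2 _) (dp2.2 _)
    _ _ _ (d_v _ _ _ LE1 dp1 eqS1)) => //.
  - by rewrite -(qE _ _ _ LE1 eqS1) -(qE _ _ _ LE2 eqS2).
  - have /matrixP/(_ iv ord0) := eqcross.
    by rewrite !lincomb !l_v // !mulr0 !add0r !Jd_v.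
  - by have /matrixP/(_ iv ord0) := eqd; rewrite [LHS]mxE [RHS]mxE !Jd_v.
have {}eqd : J *m d1 = J *m d2.
  move: eqd; rewrite eqw; apply: scalerI.
  by rewrite lt0r_neq0 // sqrtr_gt0 mulr_gt0 //; exact: dp2.2.
have eql : e^T *m L1 *m J^T = e^T *m L2 *m J^T.
  apply: trmx_inj; apply: (scalerI (lt0r_neq0 q_gt0)).
  by move: eqcross; rewrite eqds eqd => /addIr.
have {}eqOm : J *m Om1 *m J^T = J *m Om2 *m J^T.
  by apply: (scalerI _ eqOm); rewrite lt0r_neq0 // mulr_gt0.
congr (_, _, _).
- by apply: (sel_ext2 sI sN sO eqL _ eql); rewrite -!mulmxA !source_column // !mulmx0.
- apply: (sel_ext2 sI sN sO eqOm).
  + by rewrite !(diag_sel_dirac sN) ?dp1.1 ?dp2.1.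
  + by rewrite !(diag_dirac_sel sN) ?dp1.1 ?dp2.1.
  + by rewrite !mul_diracT !mul_dirac; apply/matrixP => i j; rewrite !mxE eqw.
- apply: (sel_ext sO eqd); rewrite !mul_diracT.
  by apply/matrixP => i j; rewrite !mxE (ord1 j).
Qed.

End AddSource.

(** * Adding a sink or a source *)

Theorem theorem5p1 (R : realType) (V : finType) (E : rel V)
    (acyclicE : acyclic E)
    (H : (exists s : V,
            [/\ sink E s,
                pa E s <> (~: [set s])%SET &
                generically_finitely_identifiable R
                  (induced_subgraph E (~: [set s])%SET)])
         \/
         (exists s : V,
            [/\ source E s,
                ch E s <> (~: [set s])%SET &
                generically_finitely_identifiable R
                  (induced_subgraph E (~: [set s])%SET)])) :
  generically_finitely_identifiable R E.
Proof.
have loopless u : ~~ E u u.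
  by apply/negP => /(acyclic_connectF acyclicE); apply; exact: connect0.
have missing (s : V) (A : {set V}) : s \notin A -> A <> (~: [set s])%SET ->
    exists2 v, v != s & v \notin A.
  move=> sA /eqP; rewrite finset.eqEsubset negb_and => /orP[] /fintype.subsetPn[v].
    by rewrite !inE negbK => vA /eqP vs; move: sA; rewrite -vs vA.
  by rewrite !inE; exists v.
case: H => [[s [sink_s pa_s finE']]|[s [source_s ch_s finE']]].
  have [|v vs] := missing s (pa E s) _ pa_s; first by rewrite inE.
  rewrite inE => nEvs; exact: (sink_identifiable acyclicE sink_s vs nEvs finE').
have [|v vs] := missing s (ch E s) _ ch_s; first by rewrite inE.
rewrite inE => nEsv; exact: (source_identifiable acyclicE source_s vs nEsv finE').
Qed.
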